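(* Let $p,n\in\mathbb N$ with $p\ge n-1\ge 4$, and write $p=k(n-1)+r$ with $k\in\mathbb N$ and $r\in\{0,1,\ldots,n-2\}$. Then $$ex(p;T_n^1)=\max\Big\{\Big[\tfrac{(n-2)p}{2}\Big]-(n-1+r),\ \tfrac{(n-2)p-r(n-1-r)}{2}\Big\},$$ and explicitly $$ex(p;T_n^1)=\begin{cases}\big[\tfrac{(n-2)p}{2}\big]-(n-1+r) & \text{if } n\ge 16 \text{ and } 3\le r\le n-6, \text{ or if } 13\le n\le 15 \text{ and } 4\le r\le n-7,\\[2pt] \tfrac{(n-2)p-r(n-1-r)}{2} & \text{otherwise.}\end{cases}$$
   Context: All graphs are finite and simple; a graph ''contains'' $H$ if it has a subgraph isomorphic to $H$. $\mathbb N=\{1,2,3,\ldots\}$ and $[x]$ denotes the greatest integer not exceeding $x$. For a graph $L$ and $p\in\mathbb N$, $ex(p;L)$ is the maximum number of edges in a graph on $p$ vertices that contains no copy of $L$. For $n\ge 5$, $T_n^1$ is the tree with vertex set $\{v_0,v_1,\ldots,v_{n-1}\}$ and edge set $\{v_0v_1,v_0v_2,\ldots,v_0v_{n-3},\,v_{n-4}v_{n-2},\,v_{n-3}v_{n-1}\}$. *)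

(* Defs.v *)
From mathcomp Require Import all_boot.
Set Implicit Arguments.
Unset Strict Implicit.
Unset Printing Implicit Defensive.

Definition is_graph (p : nat) (E : {set {set 'I_p}}) : bool :=
  [forall e in E, #|e| == 2].

Definition nedges (p : nat) (E : {set {set 'I_p}}) : nat := #|E|.

Definition contains (p m : nat) (G : {set {set 'I_p}}) (H : {set {set 'I_m}})
  : bool :=
  [exists f : {ffun 'I_m -> 'I_p},
     injectiveb f && [forall e in H, (f @: e) \in G]].

Definition ex (p m : nat) (L : {set {set 'I_m}}) : nat :=
  \max_(E : {set {set 'I_p}} | is_graph E && ~~ contains E L) nedges E.

Definition T1_adj (n : nat) (x y : 'I_n) : bool :=
  [|| (val x == 0) && (1 <= val y <= n - 3),
      (val x == n - 4) && (val y == n - 2)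
    | (val x == n - 3) && (val y == n - 1)].

Definition T1 (n : nat) : {set {set 'I_n}} :=
  [set [set x; y] | x in 'I_n, y in 'I_n & T1_adj x y].

(* Main.v *)
(** A copy of T_n^1 is a "spider": a centre v with two legs v - x - x' and
    v - y - y' and n - 5 further neighbours.  Put m = n - 1.

    Upper bound: by induction on the vertex set one shows that the number of
    ordered adjacent pairs is at most (m - 1) p - D(p); here D(p) is
    r (m - r) for p < m and the minimum of r (m - r) and 2 (m + r) otherwise,
    where r = p mod m.
    Let v have maximal degree d with neighbourhood N.  If d <= m - 3 the bound
    is immediate.  Otherwise the absence of a spider centred at v forces the
    edges leaving N to be concentrated on very few vertices, so some set close
    to N + v touches few edges and can be removed:
    - d = m - 2: the edges from N to the outside of N + v form a star;
    - d = m - 1: at most m (m - 1) / 2 edges touch N + v;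
    - d >= m: the edges touching N but not v pairwise intersect, hence form a
      star or a triangle (for m = 4 paths of length two are excluded as well).

    Lower bound: disjoint cliques K_m and one K_r, respectively disjoint
    cliques K_m and one almost (m - 3)-regular graph on m + r vertices. *)
Require Import Defs.
From mathcomp Require Import all_boot ssralg zmodp zify.

Set Implicit Arguments.
Unset Strict Implicit.
Unset Printing Implicit Defensive.

(** * The deficiency function *)

(** For [p < m] the complete graph on [p] vertices has exactly [(m - 1) p - p (m - p)] ordered
    pairs. The competing value [2 (m + r)] is the loss of an (m - 3)-regular graph on [m + r]
    vertices, which requires [p >= m]. *)
Definition defect (m p : nat) : nat :=
  let r := p %% m in
  if p < m then r * (m - r) else minn (r * (m - r)) (2 * (m + r)).

Lemma defect_le_quad m p : defect m p <= p %% m * (m - p %% m).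
Proof. by rewrite /defect; case: ifP => // _; rewrite geq_minl. Qed.

(** The residue is unchanged, and passing below [m] only drops one term of the minimum. Hence [m]
    vertices that touch at most [m (m - 1)] ordered pairs can be removed. *)
Lemma defect_subm m p : m <= p -> defect m p <= defect m (p - m).
Proof.
move=> le_mp; have rE : (p - m) %% m = p %% m.
  by rewrite -{2}(subnK le_mp) modnDr.
rewrite /defect rE ltnNge le_mp /=; case: ifP => // _; exact: geq_minl.
Qed.

(** From [p - (m - 1)] to [p] the residue [s] drops by one modulo [m]. If [s = 0] the new quadratic
    term is just [m - 1]; otherwise it grows by at most [2 s - m - 1], while the linear term
    decreases. *)
Lemma defect_sub_predm m p : 0 < m -> m <= p ->
  defect m p <= defect m (p - m.-1) + m.-1.
Proof.
move=> m_gt0 le_mp; set q := p - m.-1.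
have pE : p = q + m.-1 by rewrite /q; lia.
have r_lt := ltn_pmod q m_gt0.
have [q0|q_gt0] := posnP (q %% m).
  apply: leq_trans (defect_le_quad _ _) _.
  have -> : p %% m = m.-1 by rewrite pE -modnDml q0 add0n modn_small; lia.
  by nia.
have rE : p %% m = (q %% m).-1.
  rewrite pE -modnDml.
  have -> : q %% m + m.-1 = (q %% m).-1 + m by lia.
  by rewrite modnDr modn_small; lia.
rewrite /defect rE ltnNge le_mp /=; move: (q %% m) r_lt q_gt0 => s s_lt s_gt0.
have gle : s.-1 * (m - s.-1) <= s * (m - s) + m.-1.
  case: s s_gt0 s_lt {rE} => // s _ s_lt /=; have -> : m - s = (m - s.+1) + 1 by lia.
  by rewrite mulnDr mulSn muln1; lia.
case: ifP => _; first exact: leq_trans (geq_minl _ _) gle.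
rewrite addn_minl leq_min (leq_trans (geq_minl _ _) gle) /=.
by apply: leq_trans (geq_minr _ _) _; lia.
Qed.

Lemma defect_le_lin m p : 0 < m -> m <= p -> defect m p <= 2 * p.
Proof.
move=> m_gt0 le_mp; rewrite /defect ltnNge le_mp /=.
apply: leq_trans (geq_minr _ _) _.
have := divn_eq p m; have : 0 < p %/ m by rewrite divn_gt0.
by nia.
Qed.

(** Independent of the residue, from [r (m - r) <= m^2 / 4]. It fails for [m = 4], where the defect
    can be 4, so that value of [m] gets its own bound and its own large-degree case. *)
Lemma defect_bound m p : 5 <= m -> defect m p + 4 * m <= m * m + 1.
Proof.
move=> m_ge5; apply: (leq_trans (leq_add (defect_le_quad m p) (leqnn _))).
have: p %% m < m by rewrite ltn_mod; lia.
move: (p %% m) => r; have [->|m_ge6] : m = 5 \/ 6 <= m by lia.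
  by move=> r5; have : r * (5 - r) <= 6; [case: r r5 => [|[|[|[|[|]]]]] | lia].
move=> r_lt; have : 4 * (r * (m - r)) <= m * m.
  by have [+ _] := nat_AGM2 r (m - r); rewrite subnKC ?mulnn //; lia.
by nia.
Qed.

Lemma defect4_bound p : defect 4 p <= 4.
Proof.
apply: leq_trans (defect_le_quad 4 p) _.
have: p %% 4 < 4 by rewrite ltn_mod.
by case: (p %% 4) => [|[|[|[|]]]].
Qed.

(** * Spiders *)

Section Spider.
Variables (T : finType) (e : rel T).
Implicit Types (A S : {set T}) (P : {set T * T}).

(** With [m = n - 1].  For [m = 4] the cardinal condition is vacuous, so that
    every path [x' - x - v - y - y'] is excluded; this is why it is not stated
    as [#|_| < m - 4]. *)
Definition spider_free (m : nat) : Prop :=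
  forall v x y x' y', uniq [:: v; x; y; x'; y'] ->
    e v x -> e v y -> e x x' -> e y y' ->
    ~~ (m - 4 <= #|[set w | e v w] :\: [set x; y; x'; y']|).

Hypotheses (e_sym : symmetric e) (e_irr : irreflexive e).

Definition pairs (A : {set T}) : {set T * T} :=
  [set z | [&& z.1 \in A, z.2 \in A & e z.1 z.2]].

Definition nb (A : {set T}) (v : T) : {set T} := [set w in A | e v w].

Definition inc (A : {set T}) (c : T) : {set T * T} :=
  [set z in pairs A | (z.1 == c) || (z.2 == c)].

Lemma card_pairs A : #|pairs A| = \sum_(u in A) #|nb A u|.
Proof.
under eq_bigr => u _ do rewrite -sum1_card.
rewrite pair_big_dep /= -sum1_card; apply: eq_bigl => z.
by rewrite !inE.
Qed.

Lemma card_pairs_le_deg A d :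
  (forall u, u \in A -> #|nb A u| <= d) -> #|pairs A| <= #|A| * d.
Proof. by move=> dP; rewrite card_pairs -sum_nat_const leq_sum. Qed.

Lemma nb_sub A v : v \in A -> nb A v \subset A :\ v.
Proof.
move=> vA; apply/subsetP => w; rewrite !inE => /andP[-> vw].
by case: eqP vw => // ->; rewrite e_irr.
Qed.

Lemma card_pairs_le A : #|pairs A| <= #|A| * #|A|.-1.
Proof.
apply: card_pairs_le_deg => u uA.
by have := subset_leq_card (nb_sub uA); rewrite (cardsD1 u A) uA.
Qed.

Lemma card_inc A c : #|inc A c| <= 2 * #|nb A c|.
Proof.
have sub : inc A c \subset [set (c, w) | w in nb A c] :|: [set (w, c) | w in nb A c].
  apply/subsetP => -[u w]; rewrite !inE /= => /andP[/and3P[uA wA uw]].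
  case/orP => /eqP ?; subst; apply/orP; [left|right]; apply: imset_f; rewrite inE.
    by rewrite wA.
  by rewrite uA e_sym.
apply: leq_trans (subset_leq_card sub) _; apply: leq_trans (leq_card_setU _ _) _.
by rewrite mul2n -addnn leq_add // leq_imset_card.
Qed.

(** Otherwise, after deleting [x] and [y], and [x'] and [y'] where they are neighbours of [v], at
    least [m - 4] neighbours remain to complete a spider. *)
Lemma spider_forbidden m A v x y x' y' : 4 <= m -> spider_free m ->
    uniq [:: v; x; y; x'; y'] -> e v x -> e v y -> e x x' -> e y y' ->
  #|nb A v| < m - 2 + (x' \in nb A v) + (y' \in nb A v).
Proof.
move=> m_ge4 free U vx vy xx' yy'; rewrite ltnNge; apply/negP => le_nb.
have /negP[] := free _ _ _ _ _ U vx vy xx' yy'.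
apply: leq_trans (subset_leq_card (_ : nb A v :\: [set x; y; x'; y'] \subset _)).
  have -> : nb A v :\: [set x; y; x'; y'] = nb A v :\ x :\ y :\ x' :\ y'.
    by rewrite -!setDDl.
  have in_D1 w c (B : {set T}) : ((w \in B :\ c) : nat) <= (w \in B).
    by rewrite !inE; case: (_ == _).
  have := leq_trans (in_D1 x' y _) (in_D1 x' x (nb A v)).
  have := leq_trans (in_D1 y' x' _) (leq_trans (in_D1 y' y _) (in_D1 y' x (nb A v))).
  have := leq_b1 (x \in nb A v); have := leq_b1 (y \in nb A v :\ x).
  move: le_nb; rewrite (cardsD1 x) (cardsD1 y) (cardsD1 x') (cardsD1 y').
  do 6!move: (nat_of_bool _) => ?; move: #|_| => ?.
  lia.
by apply/setSD/subsetP => w; rewrite !inE => /andP[].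
Qed.

(** A pair lost with [S] has an end in [S]; symmetry of [P] reduces to the case where this is the
    first end. *)
Lemma card_pairs_remove A S P :
    (forall u w, u \in S -> u \in A -> w \in A -> e u w -> (u, w) \in P) ->
    (forall u w, (u, w) \in P -> (w, u) \in P) ->
  #|pairs A| <= #|pairs (A :\: S)| + #|P|.
Proof.
move=> subP symP; apply: leq_trans (leq_card_setU _ _).
apply/subset_leq_card/subsetP => -[u w]; rewrite !inE /= => /and3P[uA wA uw].
have [uS|uS] := boolP (u \in S); first by rewrite (subP u w) ?orbT.
have [wS|wS] := boolP (w \in S); last by rewrite uA wA uw.
by rewrite (symP w u) ?orbT // subP // e_sym.
Qed.

Lemma inc_sym A c u w : (u, w) \in inc A c -> (w, u) \in inc A c.
Proof. by rewrite !inE /= => /andP[/and3P[-> -> uw]]; rewrite orbC e_sym uw. Qed.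

Lemma pairs_sym A u w : (u, w) \in pairs A -> (w, u) \in pairs A.
Proof. by rewrite !inE /= => /and3P[-> -> uw]; rewrite e_sym uw. Qed.

(** Fix an edge [ab]. If some edge avoids [a] and some edge avoids [b], these are [bx] and [ay], and
    since they meet, [x = y]; any edge meeting [ab], [bx] and [ax] lies inside the triangle. The
    point [t0] is the centre when there is no edge. *)
Lemma star_or_triangle (F : rel T) (t0 : T) :
    symmetric F -> irreflexive F ->
    (forall u w x y, F u w -> F x y -> [|| u == x, u == y, w == x | w == y]) ->
  (exists c, forall u w, F u w -> (u == c) || (w == c)) \/
  (exists a b c, forall u w, F u w -> (u \in [set a; b; c]) && (w \in [set a; b; c])).
Proof.
move=> Fsym Firr meet.
have [/existsP[a /existsP[b ab]]|noF] := boolP [exists a, exists b, F a b]; last first.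
  left; exists t0 => u w uw; case/negP: noF.
  by apply/existsP; exists u; apply/existsP; exists w.
have star c : (~~ [exists u, exists w, [&& F u w, u != c & w != c]]) ->
    forall u w, F u w -> (u == c) || (w == c).
  move=> no u w uw; apply: contraR no; rewrite negb_or => /andP[uc wc].
  by apply/existsP; exists u; apply/existsP; exists w; rewrite uw uc wc.
have [ex_a|/star] := boolP [exists u, exists w, [&& F u w, u != a & w != a]]; last first.
  by move=> ?; left; exists a.
have [ex_b|/star] := boolP [exists u, exists w, [&& F u w, u != b & w != b]]; last first.
  by move=> ?; left; exists b.
have neq u w : F u w -> u != w by apply: contraTneq => ->; rewrite Firr.
have [x [bx xa]] : exists x, F b x /\ x != a.
  case/existsP: ex_a => u /existsP[w /and3P[uw ua wa]].
  have := meet _ _ _ _ ab uw; rewrite ![a == _]eq_sym (negPf ua) (negPf wa) /=.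
  by case/orP => /eqP E; [exists w; rewrite E|exists u; rewrite E Fsym].
have [y [ay yb]] : exists y, F a y /\ y != b.
  case/existsP: ex_b => u /existsP[w /and3P[uw ub wb]].
  have := meet _ _ _ _ ab uw; rewrite ![b == _]eq_sym (negPf ub) (negPf wb) /= !orbF.
  by case/orP => /eqP E; [exists w; rewrite E|exists u; rewrite E Fsym].
have xy : x = y.
  have := meet _ _ _ _ bx ay.
  rewrite [b == a]eq_sym (negPf (neq _ _ ab)) [b == y]eq_sym (negPf yb) (negPf xa).
  by move/eqP.
subst y; right; exists a, b, x.
have in3 u w : F u w -> u \in [set a; b; x].
  move=> uw; apply: contraT; rewrite !inE -orbA !negb_or => /and3P[ua ub ux].
  have := meet _ _ _ _ uw ab; have := meet _ _ _ _ uw bx; have := meet _ _ _ _ uw ay.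
  rewrite (negPf ua) (negPf ub) (negPf ux) /=; have [->|_] := eqVneq w a.
    by rewrite (negPf (neq _ _ ab)) (negPf (neq _ _ ay)).
  by move=> /eqP-> _; rewrite eq_sym (negPf (neq _ _ bx)).
by move=> u w uw; rewrite (in3 _ _ uw) (in3 w u) // Fsym.
Qed.

End Spider.

(** * The upper bound *)

Lemma card_setU_le (U : finType) (P Q : {set U}) : #|P :|: Q| <= #|P| + #|Q|.
Proof. by rewrite leq_card_setU. Qed.

Lemma subn2_addb m (b : bool) : 4 <= m -> m - 2 + b <= m.-1.
Proof. by case: b; lia. Qed.

Lemma card_set3_le (U : finType) (a b c : U) : #|[set a; b; c]| <= 3.
Proof. by rewrite -setUA cardsU1 cards2; case: (_ \notin _); case: (b != c). Qed.

Lemma subn2_add2b m (b1 b2 : bool) : 4 <= m -> m - 2 + b1 + b2 <= m.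
Proof. by case: b1; case: b2; lia. Qed.

Lemma sym_setU (T : finType) (P Q : {set T * T}) :
  (forall u w, (u, w) \in P -> (w, u) \in P) ->
  (forall u w, (u, w) \in Q -> (w, u) \in Q) ->
  forall u w, (u, w) \in P :|: Q -> (w, u) \in P :|: Q.
Proof.
by move=> symP symQ u w; rewrite !inE => /orP[/symP->|/symQ->] //; rewrite orbT.
Qed.

Section UpperBound.
Variables (T : finType) (e : rel T) (m : nat).
Hypotheses (e_sym : symmetric e) (e_irr : irreflexive e).
Hypotheses (m_ge4 : 4 <= m) (free : spider_free e m).
Implicit Types (A S : {set T}) (P : {set T * T}).

Local Notation pairs := (pairs e).
Local Notation nb := (nb e).
Local Notation inc := (inc e).

(** [pairs] is ordered, so its cardinal is twice the number of edges. *)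
Definition sparse A : Prop := #|pairs A| + defect m #|A| <= m.-1 * #|A|.

(** The accounting rule of the induction: every removed vertex brings a budget of [m - 1] ordered
    pairs, which must pay for the pairs touching [S] and for any increase of the defect. *)
Lemma sparse_remove A S P :
    S \subset A -> sparse (A :\: S) ->
    (forall u w, u \in S -> w \in A -> e u w -> (u, w) \in P) ->
    (forall u w, (u, w) \in P -> (w, u) \in P) ->
    #|P| + defect m #|A| <= m.-1 * #|S| + defect m (#|A| - #|S|) ->
  sparse A.
Proof.
move=> sSA; rewrite /sparse => spD subP symP leP.
have cD : #|A :\: S| = #|A| - #|S| by rewrite cardsD (setIidPr sSA).
have leA : #|S| <= #|A| by exact: subset_leq_card.
have leR := card_pairs_remove e_sym (fun u w uS _ => subP u w uS) symP.
move: spD leR; rewrite cD; have -> : m.-1 * #|A| = m.-1 * #|S| + m.-1 * (#|A| - #|S|).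
  by rewrite -mulnDr subnKC.
by move: (m.-1 * _) (m.-1 * _) leP; lia.
Qed.

Lemma pairs_inc A c u w :
  u \in A -> w \in A -> e u w -> (u == c) || (w == c) -> (u, w) \in inc A c.
Proof. by move=> uA wA uw uwc; rewrite !inE /= uA wA uw. Qed.

Lemma e_neq x y : e x y -> (x == y) = false.
Proof. by apply: contraTF => /eqP->; rewrite e_irr. Qed.

Lemma card_pairsS_le (B : {set T}) k : #|B| <= k -> #|pairs B| <= k * k.-1.
Proof.
by move=> le_k; apply: leq_trans (card_pairs_le e_irr B) _; rewrite leq_mul //; lia.
Qed.

(** * The inductive step at a vertex [v] of maximal degree *)

Section Step.
Variables (A : {set T}) (v : T).
Hypotheses (vA : v \in A) (m_le : m <= #|A|).
Hypothesis IH : forall B : {set T}, #|B| < #|A| -> sparse B.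
Hypothesis max_deg : forall u, u \in A -> #|nb A u| <= #|nb A v|.

Local Notation N := (nb A v).

Lemma v_notin_N : v \notin N.
Proof. by rewrite inE e_irr andbF. Qed.

Lemma card_vN : #|v |: N| = #|N|.+1.
Proof. by rewrite cardsU1 v_notin_N. Qed.

Lemma N_sub : N \subset A.
Proof. by apply/subsetP => w; rewrite inE => /andP[]. Qed.

Lemma vN_sub : v |: N \subset A.
Proof. by rewrite subUset sub1set vA N_sub. Qed.

Lemma NA x : x \in N -> x \in A.
Proof. exact: (subsetP N_sub). Qed.

Lemma Ne x : x \in N -> e v x.
Proof. by rewrite inE => /andP[]. Qed.

Lemma N_neq x : x \in N -> (x == v) = false.
Proof. by apply: contraTF => /eqP->; exact: v_notin_N. Qed.

Lemma IH_remove S : S \subset A -> 0 < #|S| -> sparse (A :\: S).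
Proof.
move=> sSA S_gt0; apply: IH; rewrite cardsD (setIidPr sSA).
by have := subset_leq_card sSA; lia.
Qed.

Lemma card_inc_le c : c \in A -> #|inc A c| <= 2 * #|N|.
Proof.
by move=> cA; rewrite (leq_trans (card_inc e_sym A c)) // leq_mul2l max_deg.
Qed.

(** Leg ends inside [N] are lost as further neighbours, hence the two correction terms. The four
    alternatives are the only coincidences not already ruled out by irreflexivity and the
    hypotheses. *)
Lemma no_two_legs x y x' y' :
    m - 2 + (x' \in N) + (y' \in N) <= #|N| ->
    x \in N -> y \in N -> e x x' -> e y y' -> x' != v -> y' != v ->
  [|| x == y, x == y', x' == y | x' == y'].
Proof.
move=> le_N xN yN xx' yy' x'v y'v; apply: contraLR le_N.
rewrite -ltnNge !negb_or => /and4P[xy xy' x'y x'y'].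
apply: (spider_forbidden A m_ge4 free _ (Ne xN) (Ne yN) xx' yy').
rewrite /= !inE !negb_or xy xy' x'y' andbT ![v == _]eq_sym x'v y'v.
by rewrite (N_neq xN) (N_neq yN) (e_neq xx') (e_neq yy') eq_sym x'y.
Qed.

(** The edges leaving [v |: N] from [N] pairwise meet and are bipartite, so they form a star with
    some centre [c]. The set removed is [v |: N], together with [c] if [c] lies outside. *)
Lemma sparse_deg_m2 : #|N| = m - 2 -> sparse A.
Proof.
move=> degv; have degN : #|v |: N| = m.-1 by rewrite card_vN; lia.
have meet x w y z : x \in N -> y \in N -> w \in A -> z \in A ->
    w \notin v |: N -> z \notin v |: N -> e x w -> e y z -> (x == y) || (w == z).
  move=> xN yN wA zA; rewrite ![_ \in v |: _]in_setU1 !negb_or.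
  move=> /andP[wv wN] /andP[zv zN] xw yz.
  have := no_two_legs _ xN yN xw yz wv zv; rewrite (negPf wN) (negPf zN) degv !addn0.
  move=> /(_ (leqnn _)) /or4P[->|/eqP E|/eqP E|->] //; last by rewrite orbT.
    by rewrite -E xN in zN.
  by rewrite E yN in wN.
have [c cA cP] : exists2 c, c \in A :\ v &
    forall x w, x \in N -> w \in A -> w \notin v |: N -> e x w -> (x == c) || (w == c).
  have [/existsP[a /existsP[b /and4P[aN bA bN ab]]]|no] :=
      boolP [exists a, exists b, [&& a \in N, b \in A, b \notin v |: N & e a b]]; last first.
    (* No edge leaves, so any vertex of [N] serves as centre. *)
    have /card_gt0P[c cN] : 0 < #|N| by lia.
    exists c; first by rewrite in_setD1 (N_neq cN) NA.
    move=> x w xN wA wN xw; case/negP: no.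
    by apply/existsP; exists x; apply/existsP; exists w; rewrite xN wA wN.
  (* Either all leaving edges start at [a], or one starts elsewhere; the latter must end at [b], and
     then [b] is the centre. *)
  have [/existsP[y /existsP[z /and5P[yN zA zN yz ya]]]|no] :=
      boolP [exists y, exists z, [&& y \in N, z \in A, z \notin v |: N, e y z & y != a]]; last first.
    exists a; first by rewrite in_setD1 (N_neq aN) NA.
    move=> x w xN wA wN xw; apply: contraR no; rewrite negb_or => /andP[xa _].
    by apply/existsP; exists x; apply/existsP; exists w; rewrite xN wA wN xw.
  exists b; first by rewrite in_setD1 bA andbT; apply: contra bN => /eqP->; rewrite setU11.
  move=> x w xN wA wN xw; have := meet _ _ _ _ aN yN bA zA bN zN ab yz.
  rewrite eq_sym (negPf ya) /= => /eqP bz; subst z.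
  have := meet _ _ _ _ xN aN wA bA wN bN xw ab; have := meet _ _ _ _ xN yN wA bA wN bN xw yz.
  have [_|_] := eqVneq w b; first by rewrite !orbT.
  by rewrite !orbF => /eqP-> /eqP E; rewrite E eqxx in ya.
move: cA; rewrite in_setD1 => /andP[cv cA].
have cross u w : u \in v |: N -> w \in A -> e u w -> u != c -> w != c -> w \in v |: N.
  move=> uN wA uw uc wc; apply: contraT => wN.
  move: uN; rewrite in_setU1 => /orP[/eqP E|uN].
    by case/negP: wN; rewrite in_setU1 inE wA -E uw orbT.
  by have := cP u w uN wA wN uw; rewrite (negPf uc) (negPf wc).
have leI := card_inc_le cA; rewrite degv in leI.
have [cN|cN] := boolP (c \in N).
  apply: (@sparse_remove A (v |: N) (pairs ((v |: N) :\ c) :|: inc A c)).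
  - exact: vN_sub.
  - by apply: IH_remove vN_sub _; rewrite degN; lia.
  - move=> u w uN wA uw; rewrite inE; apply/orP.
    have uA := subsetP vN_sub u uN.
    have [uc|uc] := boolP (u == c); first by right; apply: pairs_inc; rewrite ?uc.
    have [wc|wc] := boolP (w == c); first by right; apply: pairs_inc; rewrite ?wc ?orbT.
    by left; rewrite inE /= !in_setD1 uc wc uN uw (cross u w).
  - by apply: sym_setU => u w; [exact: pairs_sym|exact: inc_sym].
  (* The pairs number at most [(m - 2) (m - 3) + 2 (m - 2) = (m - 1) (m - 2)], which is [m - 1]
     below the budget [(m - 1)^2]: exactly the cost in [defect_sub_predm]. *)
  - rewrite degN.
    have : #|(v |: N) :\ c| <= m - 2.
      by move: degN; rewrite (cardsD1 c) in_setU1 cN orbT; lia.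
    move/card_pairsS_le => leP.
    have := defect_sub_predm (ltnW (ltnW (ltnW m_ge4))) m_le.
    have := card_setU_le (pairs ((v |: N) :\ c)) (inc A c).
    case: m m_ge4 leP leI => [|[|[|k]]] //= _; rewrite !subSS !subn0.
    by nia.
apply: (@sparse_remove A (c |: (v |: N)) (pairs (v |: N) :|: inc A c)).
- by rewrite subUset sub1set cA vN_sub.
- apply: IH_remove; first by rewrite subUset sub1set cA vN_sub.
  by rewrite card_gt0; apply/set0Pn; exists c; rewrite setU11.
- move=> u w uN wA uw; rewrite inE; apply/orP.
  have uA : u \in A by move: uN; rewrite in_setU1 => /orP[/eqP->|/(subsetP vN_sub)].
  have [uc|uc] := boolP (u == c); first by right; apply: pairs_inc; rewrite ?uc.
  have [wc|wc] := boolP (w == c); first by right; apply: pairs_inc; rewrite ?wc ?orbT.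
  move: uN; rewrite in_setU1 (negPf uc) /= => uN.
  by left; rewrite inE /= uN uw (cross u w).
- by apply: sym_setU => u w; [exact: pairs_sym|exact: inc_sym].
- have -> : #|c |: (v |: N)| = m by rewrite cardsU1 in_setU1 negb_or cv cN /= degN; lia.
  have := defect_subm m_le; have := card_setU_le (pairs (v |: N)) (inc A c).
  have /card_pairsS_le : #|v |: N| <= m.-1 by rewrite degN.
  case: m m_ge4 leI => [|[|[|k]]] //= _; rewrite !subSS !subn0.
  by nia.
Qed.

(** Removing the [m] vertices of [v |: N] keeps the residue, so it suffices to enclose the edges
    touching them in a symmetric set of at most [m (m - 1)] pairs. *)
Lemma sparse_deg_m1 : #|N| = m.-1 -> sparse A.
Proof.
move=> degv; have degN : #|v |: N| = m by rewrite card_vN; lia.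
suff [P] : exists P, [/\ forall u w, u \in v |: N -> w \in A -> e u w -> (u, w) \in P,
    forall u w, (u, w) \in P -> (w, u) \in P & #|P| <= m.-1 * m].
  case=> subP symP leP; apply: (sparse_remove vN_sub _ subP symP).
    by apply: IH_remove vN_sub _; rewrite degN; lia.
  by rewrite degN leq_add // defect_subm.
have [/existsP[y /existsP[y' /and4P[yN yA' yN' yy']]]|no] :=
    boolP [exists a, exists b, [&& a \in N, b \in A, b \notin v |: N & e a b]]; last first.
  exists (pairs (v |: N)); split; first last.
  - by rewrite mulnC; apply: card_pairsS_le; rewrite degN.
  - by move=> u w; exact: pairs_sym.
  move=> u w uN wA uw; rewrite inE /= uN uw andbT /=.
  apply: contraR no => wN; apply/existsP; exists u; apply/existsP; exists w.
  rewrite wA wN uw !andbT; move: uN; rewrite in_setU1 => /orP[/eqP E|//].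
  by case/negP: wN; rewrite in_setU1 inE wA -E uw orbT.
(* The leg through [z] ends at [y'], outside [N]; at most one leg end lies in [N], so degree [m - 1]
   suffices to exclude disjoint legs. *)
have fact z x x' : z \in N -> e z y' -> x \in N -> x != z -> x' \in A -> e x x' ->
    x' \in [set v; z; y'].
  move=> zN zy' xN xz xA' xx'; rewrite !inE -orbA.
  have [//|x'v] := eqVneq x' v.
  move: (yN'); rewrite in_setU1 negb_or => /andP[y'v y'N].
  have := @no_two_legs x z x' y' _ xN zN xx' zy' x'v y'v.
  rewrite (negPf xz) (negPf y'N) degv addn0 /= => meet.
  have /meet/or3P[/eqP E|->|->] : m - 2 + (x' \in N) <= m.-1 by exact: subn2_addb.
  - by rewrite -E xN in y'N.
  - by [].
  - by rewrite orbT.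
have inN u : u \in v |: N -> u != v -> u \in N by rewrite in_setU1 => /orP[->|].
have vI := card_inc_le vA; rewrite degv in vI.
(* If [y] is the only neighbour of [y'] in [N], every edge at [N] passes through [v] or [y]. *)
have [/existsP[x /and3P[xN xy xy']]|no] := boolP [exists x, [&& x \in N, x != y & e x y']]; last first.
  exists (inc A v :|: inc A y); split; first last.
  - apply: leq_trans (card_setU_le _ _) _; have := card_inc_le (NA yN); rewrite degv.
    by nia.
  - by apply: sym_setU => u w; exact: inc_sym.
  move=> u w uN wA uw; have uA := subsetP vN_sub u uN; rewrite inE; apply/orP.
  have [uv|uv] := boolP (u == v); first by left; apply: pairs_inc; rewrite ?uv.
  have [uy|uy] := boolP (u == y); first by right; apply: pairs_inc; rewrite ?uy.
  have {}uN := inN _ uN uv.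
  have := fact y u w yN yy' uN uy wA uw; rewrite !inE -orbA => /or3P[wv|wy|/eqP E].
  - by left; rewrite uA wA uw wv orbT.
  - by right; rewrite uA wA uw wy orbT.
  - by case/negP: no; apply/existsP; exists u; rewrite uN uy -E.
have y'neq z : z \in N -> (y' == z) = false.
  move=> zN; apply: contraNF yN' => /eqP->.
  by rewrite in_setU1 zN orbT.
(* If [x] and [y] are adjacent, the edges at [N] avoiding [v] lie in the triangle [x], [y], [y']; a
   third neighbour of [y'] in [N] would contradict [fact] for the edge [xy]. *)
have [exy|nexy] := boolP (e x y).
  have third z : z \in N -> e z y' -> (z == x) || (z == y).
    move=> zN zy'; apply: contraT; rewrite negb_or => /andP[zx zy].
    have := fact z x y zN zy' xN _ (NA yN) exy; rewrite eq_sym zx => /(_ isT).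
    by rewrite !inE (N_neq yN) [y == z]eq_sym (negPf zy) [y == y']eq_sym (y'neq _ yN).
  exists (inc A v :|: pairs [set x; y; y']); split; first last.
  - apply: leq_trans (card_setU_le _ _) _.
    have := card_pairsS_le (card_set3_le x y y').
    by nia.
  - by apply: sym_setU => u w; [exact: inc_sym|exact: pairs_sym].
  move=> u w uN wA uw; have uA := subsetP vN_sub u uN; rewrite inE; apply/orP.
  have [uv|uv] := boolP (u == v); first by left; apply: pairs_inc; rewrite ?uv.
  have [wv|wv] := boolP (w == v); first by left; apply: pairs_inc; rewrite ?wv ?orbT.
  have {}uN := inN _ uN uv; right.
  have fx := fact x u w xN xy' uN _ wA uw; have fy := fact y u w yN yy' uN _ wA uw.
  rewrite !inE (negPf wv) /= in fx fy; rewrite !inE /= uw andbT.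
  have [ux|ux] := eqVneq u x.
    by rewrite /=; move: fy; rewrite ux xy => /(_ isT) /orP[->|->]; rewrite ?orbT.
  have [uy|uy] := eqVneq u y.
    by rewrite /=; move: fx; rewrite ux => /(_ isT) /orP[->|->]; rewrite ?orbT.
  move: fx fy; rewrite ux uy => /(_ isT) fx /(_ isT).
  have [E|wy'] := eqVneq w y'.
    by have := third u uN; rewrite -E uw (negPf ux) (negPf uy) => /(_ isT).
  by move: fx; rewrite (negPf wy') !orbF => /eqP-> /eqP E; rewrite E eqxx in xy.
(* Otherwise every edge at [N] passes through [v] or [y']. *)
exists (inc A v :|: inc A y'); split; first last.
- apply: leq_trans (card_setU_le _ _) _; have := card_inc_le yA'; rewrite degv.
  by nia.
- by apply: sym_setU => u w; exact: inc_sym.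
move=> u w uN wA uw; have uA := subsetP vN_sub u uN; rewrite inE; apply/orP.
have [uv|uv] := boolP (u == v); first by left; apply: pairs_inc; rewrite ?uv.
have [wv|wv] := boolP (w == v); first by left; apply: pairs_inc; rewrite ?wv ?orbT.
have {}uN := inN _ uN uv; right; apply: pairs_inc => //; apply/orP; right.
have fx := fact x u w xN xy' uN _ wA uw; have fy := fact y u w yN yy' uN _ wA uw.
rewrite !inE (negPf wv) /= in fx fy; apply: contraT => wy'.
rewrite (negPf wy') !orbF in fx fy.
have [ux|ux] := eqVneq u x.
  by move: fy uw; rewrite ux xy => /(_ isT)/eqP->; rewrite (negPf nexy).
have [uy|uy] := eqVneq u y.
  by move: fx uw; rewrite ux uy => /(_ isT)/eqP->; rewrite e_sym (negPf nexy).
by move: (fx ux) (fy uy) => /eqP-> /eqP E; rewrite E eqxx in xy.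
Qed.

(** With degree at least [m], disjoint legs are impossible even if both ends lie in [N]. So the
    edges meeting [N] and avoiding [v] form a star or a triangle, and the removed set is large
    enough for the crude [defect_bound]. *)
Lemma sparse_deg_ge : 5 <= m -> m <= #|N| -> sparse A.
Proof.
move=> m_ge5 degv; have vI := card_inc_le vA.
have leD := defect_bound #|A| m_ge5.
have leg x y x' y' := @no_two_legs x y x' y' (leq_trans (subn2_add2b _ _ m_ge4) degv).
pose F u w := [&& u \in A, w \in A, e u w, u != v, w != v & (u \in N) || (w \in N)].
have Fsym : symmetric F.
  by move=> u w; rewrite /F e_sym orbC; do 2!case: (_ \in A); case: (_ == v); case: (_ == v).
have Firr : irreflexive F by move=> u; rewrite /F e_irr !andbF.
have FP u w : u \in N -> w \in A -> e u w -> w != v -> F u w.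
  by move=> uN wA uw wv; rewrite /F uN wA uw wv NA ?N_neq.
have meet u w x y : F u w -> F x y -> [|| u == x, u == y, w == x | w == y].
  have meetN a b c d : a \in N -> c \in N -> F a b -> F c d ->
      [|| a == c, a == d, b == c | b == d].
    by move=> aN cN /and5P[_ _ ab _ /andP[bv _]] /and5P[_ _ cd _ /andP[dv _]]; apply: leg.
  move=> Fuw Fxy; have : (u \in N) || (w \in N) by case/and5P: Fuw => _ _ _ _ /andP[].
  have : (x \in N) || (y \in N) by case/and5P: Fxy => _ _ _ _ /andP[].
  move=> /orP[xN|yN] /orP[uN|wN].
  - exact: meetN.
  - by have := meetN w u x y wN xN; rewrite Fsym => /(_ Fuw Fxy)/or4P[]->; rewrite ?orbT.
  - by have := meetN u w y x uN yN; rewrite [F y x]Fsym => /(_ Fuw Fxy)/or4P[]->; rewrite ?orbT.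
  - have := meetN w u y x wN yN; rewrite [F y x]Fsym [F w u]Fsym.
    by move=> /(_ Fuw Fxy)/or4P[]->; rewrite ?orbT.
have sparse_vN P :
    (forall u w, u \in N -> w \in A -> e u w -> w != v -> (u, w) \in inc A v :|: P) ->
    (forall u w, (u, w) \in P -> (w, u) \in P) ->
    #|inc A v :|: P| + m * m + 1 <= m.-1 * #|N|.+1 + 4 * m -> sparse A.
  move=> subP symP leP; apply: (@sparse_remove A (v |: N) (inc A v :|: P)).
  - exact: vN_sub.
  - by apply: IH_remove vN_sub _; rewrite card_vN.
  - move=> u w; rewrite in_setU1 => /orP[/eqP->|uN] wA uw.
      by rewrite inE pairs_inc ?eqxx.
    have [wv|wv] := boolP (w == v); last exact: subP.
    by rewrite inE pairs_inc // ?wv ?orbT // NA.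
  - exact: sym_setU (@inc_sym _ _ e_sym A v) symP.
  - by move: leD leP; rewrite card_vN; clear; lia.
have [[c cP]|[a [b [c abcP]]]] := star_or_triangle v Fsym Firr meet; last first.
  apply: (sparse_vN (pairs [set a; b; c])).
  - move=> u w uN wA uw wv; rewrite inE; apply/orP; right.
    by have /andP[uabc wabc] := abcP u w (FP _ _ uN wA uw wv); rewrite inE /= uabc wabc.
  - by move=> u w; exact: pairs_sym.
  - have := card_setU_le (inc A v) (pairs [set a; b; c]).
    have := card_pairsS_le (card_set3_le a b c).
    move: vI degv; clear -m_ge5; move: #|N| #|inc A v| #|inc A v :|: _| #|pairs _|.
    case: m m_ge5 => // k m_ge5 d i s t /=; nia.
have [cN|cN] := boolP (c \in N).
  apply: (sparse_vN (inc A c)).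
  - move=> u w uN wA uw wv; rewrite inE; apply/orP; right.
    by apply: pairs_inc => //; [exact: NA|exact: cP (FP _ _ uN wA uw wv)].
  - by move=> u w; exact: inc_sym.
  (* The two pairs counted twice matter: for degree [m] the required inequality is the equality [(4
     m - 2) + m^2 + 1 = (m - 1) (m + 1) + 4 m]. *)
  - have : 2 <= #|inc A v :&: inc A c|.
      have <- : #|[set (v, c); (c, v)]| = 2.
        by rewrite cards2 xpair_eqE (N_neq cN) andbF.
      apply/subset_leq_card/subsetP => z; rewrite !inE.
      by case/orP => /eqP-> /=; rewrite vA (NA cN) ?(Ne cN) ?[e c v]e_sym ?(Ne cN) !eqxx ?orbT.
    have := cardsUI (inc A v) (inc A c); have := card_inc_le (NA cN).
    move: vI degv; clear -m_ge5; move: #|N| #|inc A v| #|inc A c| #|_ :|: _| #|_ :&: _|.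
    case: m m_ge5 => // k m_ge5 d i s t r /=; nia.
have [cA|cA] := boolP (c \in A :\ v); last first.
  apply: (sparse_vN set0).
  - move=> u w uN wA uw wv; case/negP: cA; rewrite in_setD1.
    have := cP u w (FP _ _ uN wA uw wv).
    by case/orP => /eqP <-; rewrite ?wv ?wA // NA ?N_neq.
  - by move=> u w; rewrite inE.
  - rewrite setU0; move: vI degv; clear -m_ge5; move: #|N| #|inc A v|.
    case: m m_ge5 => // k m_ge5 d i /=; nia.
move: cA; rewrite in_setD1 => /andP[cv cA].
apply: (@sparse_remove A (c |: (v |: N)) (inc A v :|: inc A c)).
- by rewrite subUset sub1set cA vN_sub.
- apply: IH_remove; first by rewrite subUset sub1set cA vN_sub.
  by rewrite card_gt0; apply/set0Pn; exists c; rewrite setU11.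
- move=> u w; rewrite !in_setU1 => /or3P[/eqP->|/eqP->|uN] wA uw; rewrite inE; apply/orP.
  + by right; apply: pairs_inc; rewrite ?eqxx.
  + by left; apply: pairs_inc; rewrite ?eqxx.
  have [wv|wv] := boolP (w == v); first by left; rewrite pairs_inc // ?wv ?orbT // NA.
  by right; apply: pairs_inc => //; [exact: NA|exact: cP (FP _ _ uN wA uw wv)].
- by apply: sym_setU => u w; exact: inc_sym.
- have -> : #|c |: (v |: N)| = #|N|.+2 by rewrite cardsU1 in_setU1 negb_or cv cN card_vN.
  have := card_inc_le cA; have := card_setU_le (inc A v) (inc A c).
  move: vI degv leD; clear -m_ge5; move: #|inc A v| #|inc A c| #|_ :|: _|.
  move: (defect m #|A|) (defect m _) #|N|.
  case: m m_ge5 => // k m_ge5 D D' d i j s /=; nia.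
Qed.

(** For [m = 4] all paths on five vertices are excluded. This also restricts paths not centred at
    [v], which compensates for the small budget of 3 pairs per vertex. *)
Lemma sparse_deg4 : m = 4 -> 4 <= #|N| -> sparse A.
Proof.
move=> m4 degv; have vI := card_inc_le vA.
have leD := defect4_bound #|A|.
have no_path x' x y y' c : uniq [:: c; x; y; x'; y'] ->
    e c x -> e c y -> e x x' -> e y y' -> False.
  by move=> U cx cy xx' yy'; have := free U cx cy xx' yy'; rewrite m4.
have no_legs u w x y : u \in N -> x \in N -> e u w -> e x y -> w != v -> y != v ->
    [|| u == x, u == y, w == x | w == y].
  move=> uN xN uw xy wv yv; apply: contraT; rewrite !negb_or => /and4P[ux uy wx wy].
  exfalso; apply: (no_path w u x y v _ (Ne uN) (Ne xN) uw xy).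
  rewrite /= !inE !negb_or ![v == _]eq_sym !(N_neq uN, N_neq xN) wv yv ux uy wy.
  by rewrite (e_neq uw) (e_neq xy) eq_sym wx.
(* Degree 4 supplies a neighbour [l] of [v] other than [a], [b], [c], and [l - v - a - b - c] is a
   path centred at [a]. *)
have no_long a b c : a \in N -> b != v -> c != v -> a != c -> e a b -> e b c -> False.
  move=> aN bv cv ac ab bc.
  have [l lN] : exists l, l \in N :\: [set a; b; c].
    apply/set0Pn; rewrite -card_gt0 cardsD.
    have := subset_leq_card (subsetIr N [set a; b; c]); have := card_set3_le a b c.
    by move: degv; clear; lia.
  move: lN; rewrite !inE !negb_or => /andP[/andP[/andP[la lb] lc] /andP[_ vl]].
  apply: (no_path l v b c a) => //; try by rewrite e_sym // Ne.
  rewrite /= !inE !negb_or ac (N_neq aN) (e_neq ab) (e_neq bc) (e_neq vl).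
  by rewrite ![v == _]eq_sym ![_ == l]eq_sym la lb lc bv cv.
(* Here [2 * #|N|] pays for the pairs at [v], and 4 bounds the defect. *)
have sparse_P S P : S \subset v |: N -> v \in S ->
    (forall u w, u \in N -> u \in S -> w \in A -> e u w -> w != v -> (u, w) \in P) ->
    (forall u w, (u, w) \in P -> (w, u) \in P) ->
    #|P| + 2 * #|N| + 4 <= 3 * #|S| -> sparse A.
  move=> sSN vS subP symP leP; have sSA := subset_trans sSN vN_sub.
  apply: (@sparse_remove A S (inc A v :|: P)) => //.
  - by apply: IH_remove => //; rewrite card_gt0; apply/set0Pn; exists v.
  - move=> u w uS wA uw; rewrite inE; apply/orP; have uA := subsetP sSA u uS.
    have [uv|uv] := boolP (u == v); first by left; apply: pairs_inc; rewrite ?uv.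
    have [wv|wv] := boolP (w == v); first by left; apply: pairs_inc; rewrite ?wv ?orbT.
    right; apply: subP => //.
    by have := subsetP sSN u uS; rewrite in_setU1 (negPf uv).
  - exact: sym_setU (@inc_sym _ _ e_sym A v) symP.
  - have := card_setU_le (inc A v) P; move: vI leP leD; rewrite m4 /=; clear; lia.
have [/existsP[a /existsP[b /and3P[aN bN ab]]]|no] :=
    boolP [exists a, exists b, [&& a \in N, b \in N & e a b]].
  apply: (@sparse_P (v |: N) (pairs [set a; b])) => //; first exact: setU11.
  - move=> u w uN _ wA uw wv; rewrite !inE /= uw andbT.
    have := no_legs u w a b uN aN uw ab wv; rewrite (N_neq bN) => /(_ isT).
    have [ua|ua] /= := eqVneq u a.
      move=> _; apply: contraT; rewrite negb_or => /andP[_ wb].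
      case: (no_long b a w) => //; rewrite ?N_neq // 1?eq_sym //; first by rewrite e_sym.
      by rewrite -ua.
    have [ub|ub] /= := eqVneq u b.
      move=> _; apply: contraT; rewrite negb_or => /andP[wa _].
      by case: (no_long a b w) => //; rewrite ?N_neq // 1?eq_sym // -ub.
    move/orP=> [/eqP wa|/eqP wb].
      by case: (no_long u a b) => //; rewrite ?N_neq // -wa.
    by case: (no_long u b a) => //; rewrite ?N_neq // -?wb // e_sym wb.
  - by move=> u w; exact: pairs_sym.
  - have := card_pairs_le e_irr [set a; b]; rewrite cards2 (e_neq ab) /= card_vN.
    by move: degv; clear; lia.
have noN u w : u \in N -> w \in N -> e u w = false.
  move=> uN wN; apply: contraNF no => uw.
  by apply/existsP; exists u; apply/existsP; exists w; rewrite uN wN.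
have [/existsP[a /existsP[b /and4P[aN bA bv ab]]]|no'] :=
    boolP [exists a, exists b, [&& a \in N, b \in A, b != v & e a b]]; last first.
  apply: (@sparse_P (v |: N) set0) => //; first exact: setU11.
  - move=> u w uN _ wA uw wv; case/negP: no'.
    by apply/existsP; exists u; apply/existsP; exists w; rewrite uN wA wv.
  - by move=> u w; rewrite inE.
  - by rewrite cards0 card_vN; move: degv; clear; lia.
(* The vertex [a] stays because it may have further edges; every other vertex of [N] is a leaf at
   [v]. The count [2 d + 4 <= 3 d] needs degree [d >= 4]. *)
apply: (@sparse_P ((v |: N) :\ a) set0) => //.
- by rewrite subD1set.
- by rewrite in_setD1 setU11 eq_sym (N_neq aN).
- move=> u w uN; rewrite in_setD1 => /andP[ua _] wA uw wv; exfalso.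
  have := no_legs u w a b uN aN uw ab wv bv; rewrite (negPf ua) /=.
  case/or3P => [/eqP E|/eqP E|/eqP E].
  - by move: ab; rewrite -E e_sym noN // E.
  - by move: uw; rewrite E noN.
  - by apply: (no_long a b u) => //; rewrite ?N_neq 1?eq_sym // -E e_sym.
- by move=> u w; rewrite inE.
- have := cardsD1 a (v |: N); rewrite in_setU1 aN orbT card_vN cards0 => E.
  by move: degv E; clear; lia.
Qed.

End Step.

Theorem spider_free_sparse A : sparse A.
Proof.
have [k] := ubnP #|A|; elim: k A => // k IHk A /ltnSE-leAk.
have m_gt0 : 0 < m by apply: leq_trans m_ge4.
(* Up to [m] vertices, counting all pairs gives the bound; at [m] itself the residue and the defect
   are 0. *)
have [le_Am|lt_mA] := leqP #|A| m.
  have := card_pairs_le e_irr A; rewrite /sparse /defect.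
  move: #|A| le_Am #|pairs A| => a; rewrite leq_eqVlt => /orP[/eqP->|lt_am] s le_s.
    by rewrite ltnn modnn mul0n min0n addn0 mulnC.
  rewrite lt_am modn_small //; apply: leq_trans (leq_add le_s (leqnn _)) _.
  by rewrite -mulnDr mulnC leq_mul2r; move: lt_am; clear; case: a => //= a; lia.
have IH (B : {set T}) : #|B| < #|A| -> sparse B by move=> ltB; apply: IHk; apply: leq_trans leAk.
have [v0 v0A] : exists v0, v0 \in A by apply/card_gt0P; apply: leq_trans lt_mA.
have [v vA max_deg] := arg_maxnP (fun u => #|nb A u|) v0A.
have le_mA := ltnW lt_mA.
have [le_d|gt_d] := leqP #|nb A v| (m - 3).
  have := card_pairs_le_deg (fun u uA => leq_trans (max_deg u uA) le_d).
  have := defect_le_lin m_gt0 le_mA; rewrite /sparse.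
  move: #|A| #|pairs A| (defect _ _) => a s D; move: m_ge4; clear.
  by case: m => [|[|[|k]]] //= _; rewrite !subSS subn0; nia.
have [d2|d2] := eqVneq #|nb A v| (m - 2); first exact: (sparse_deg_m2 vA).
have [d1|d1] := eqVneq #|nb A v| m.-1; first exact: (sparse_deg_m1 vA).
have le_md : m <= #|nb A v| by move: m_ge4 gt_d d2 d1; clear; lia.
have [m4|m4] := eqVneq m 4; first by apply: (sparse_deg4 vA) => //; rewrite -m4.
by apply: (sparse_deg_ge vA) => //; move: m_ge4 m4; clear; lia.
Qed.

End UpperBound.

(** * Spiders and copies of the tree *)

Lemma card_pairs_setT (T : finType) (e : rel T) :
  #|pairs e setT| = \sum_u #|[set w | e u w]|.
Proof.
rewrite card_pairs; apply: eq_big => [u|u _]; first by rewrite inE.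
by apply: eq_card => w; rewrite !inE.
Qed.

Section Tree.
Variable p : nat.
Implicit Type E : {set {set 'I_p}}.

Definition adj E : rel 'I_p := fun u w => [set u; w] \in E.

Lemma adj_sym E : symmetric (adj E).
Proof. by move=> u w; rewrite /adj setUC. Qed.

Lemma adj_irr E : is_graph E -> irreflexive (adj E).
Proof.
move=> /forall_inP gE u; apply/negP => /gE.
by rewrite setUid cards1.
Qed.

Lemma card_pairs_adj E : is_graph E -> #|pairs (adj E) setT| = 2 * nedges E.
Proof.
move=> gE; have /forall_inP gP := gE.
rewrite -sum1_card (partition_big (fun z => [set z.1; z.2]) (mem E)) /=; last first.
  by move=> z; rewrite !inE.
rewrite (eq_bigr (fun=> 2)) ?sum_nat_const 1?mulnC // => s sE.
have /cards2P[a [b [ab sab]]] := gP s sE.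
have -> : 2 = #|[set (a, b); (b, a)]| by rewrite cards2 xpair_eqE (negPf ab).
rewrite -sum1_card; apply: eq_bigl => -[u w]; rewrite !inE /= /adj !xpair_eqE.
apply/andP/orP => [[uw /eqP uwE]|[] /andP[/eqP-> /eqP->]].
- have neq : u != w by apply: contraTneq uw => ->; have := adj_irr gE w; rewrite /adj => ->.
  move: (set21 u w) (set22 u w); rewrite uwE sab !inE.
  by case/orP=> /eqP ua; case/orP=> /eqP wa; move: neq; rewrite ua wa ?eqxx => //; [left|right].
- by rewrite -sab sE sab.
- by rewrite setUC -sab sE sab.
Qed.

(** With [n = k + 5], vertex 0 is the centre, the legs are [0, k+1, k+3] and [0, k+2, k+4], and
    vertices [1] to [k] are the [m - 4] further neighbours. *)
Lemma contains_spider n E : 5 <= n -> is_graph E ->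
  contains E (T1 n) -> ~ spider_free (adj E) n.-1.
Proof.
case: n => [|[|[|[|[|k]]]]] // _ gE /existsP[f /andP[/injectiveP f_inj /forall_inP fE]] free.
have fadj a b : T1_adj a b -> adj E (f a) (f b).
  move=> ab; have -> : adj E (f a) (f b) = (f @: [set a; b] \in E).
    by rewrite imsetU1 imset_set1.
  apply: fE.
  by apply/imset2P; exists a b; rewrite ?inE.
pose v i := f (inord i).
have vE i j : i < k.+4.+1 -> j < k.+4.+1 -> (v i == v j) = (i == j).
  by move=> ik jk; rewrite (inj_eq f_inj) -val_eqE /= !inordK.
have vadj i j : i < k.+4.+1 -> j < k.+4.+1 ->
    [|| (i == 0) && (0 < j <= k.+2), (i == k.+1) && (j == k.+3) | (i == k.+2) && (j == k.+4)] ->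
    adj E (v i) (v j).
  move=> ik jk ij; apply: fadj; rewrite /T1_adj /= !inordK // !subSS !subn0.
have := free (v 0) (v k.+1) (v k.+2) (v k.+3) (v k.+4).
have -> : uniq [:: v 0; v k.+1; v k.+2; v k.+3; v k.+4].
  by rewrite /= !inE !vE //; lia.
rewrite !vadj ?eqxx ?ltnSn ?orbT //=; try lia.
move=> /(_ isT isT isT isT isT)/negP; apply.
rewrite !subSS subn0.
have cardL : #|[set v i.+1 | i : 'I_k]| = k.
  rewrite card_imset ?card_ord // => i j /eqP.
  by rewrite vE ?eqSS => [/eqP/val_inj||] //; have := ltn_ord i; have := ltn_ord j; lia.
rewrite -[X in X <= _]cardL; apply/subset_leq_card/subsetP => w /imsetP[i _ ->]; have ik := ltn_ord i.
have v0i : adj E (v 0) (v i.+1) by apply: vadj; lia.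
by rewrite !inE v0i andbT !vE; lia.
Qed.

Lemma spider_contains n E : 5 <= n -> is_graph E ->
  ~~ contains E (T1 n) -> spider_free (adj E) n.-1.
Proof.
case: n => [|[|[|[|[|k]]]]] // _ gE noT v x y x' y' U vx vy xx' yy'.
apply: contra noT; rewrite /= !subSS subn0; set R := _ :\: _ => leR.
(* The list follows the vertex numbering of [T1]: centre, [k] further neighbours, inner leg
   vertices, leaves. *)
pose s := v :: take k (enum R) ++ [:: x; y; x'; y'].
have size_take : size (take k (enum R)) = k by rewrite size_takel // -cardE.
have size_s : size s = k.+4.+1 by rewrite /= size_cat size_take /= addn4.
have take_R w : w \in take k (enum R) -> w \in R by move/mem_take; rewrite mem_enum.
have uniq_s : uniq s.
  have /andP[vnot U'] : (v \notin [:: x; y; x'; y']) && uniq [:: x; y; x'; y'] := U.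
  rewrite /s cons_uniq cat_uniq U' take_uniq ?enum_uniq // andbT mem_cat negb_or vnot !andbT.
  apply/andP; split.
    by apply/negP => /take_R; rewrite !inE (adj_irr gE) andbF.
  apply/hasPn => w; rewrite !inE => wX; apply/negP => /take_R.
  by rewrite !inE -!orbA wX.
pose f := [ffun i : 'I_k.+4.+1 => nth v s i].
have fk j : nth v s (k.+1 + j) = nth v [:: x; y; x'; y'] j.
  by rewrite addSn /= nth_cat size_take ltnNge leq_addr addKn.
have nxt a b : T1_adj a b -> adj E (f a) (f b).
  rewrite !ffunE /T1_adj !subSS !subn0 => /or3P[/andP[/eqP-> bk]|/andP[/eqP-> /eqP->]|/andP[/eqP-> /eqP->]].
  - have {}bk : 0 < nat_of_ord b <= k.+2 := bk.
    have [bk1|bk1] := leqP b k.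
      have /take_R : nth v s b \in take k (enum R).
        case: (nat_of_ord b) bk bk1 => // j _ jk; rewrite /s /= nth_cat size_take jk mem_nth //.
        by rewrite size_take.
      by rewrite !inE => /andP[].
    have [->|->] : nat_of_ord b = k.+1 + 0 \/ nat_of_ord b = k.+1 + 1 by lia.
      by rewrite fk.
    by rewrite fk.
  - by have := fk 0; have := fk 2; rewrite addn0 addn2 => -> ->.
  - by have := fk 1; have := fk 3; rewrite addn1 addn3 => -> ->.
apply/existsP; exists f; apply/andP; split.
  apply/injectiveP => i j; rewrite !ffunE => /eqP.
  by rewrite nth_uniq ?size_s // => /eqP/val_inj.
apply/forall_inP => e /imset2P[a b _]; rewrite inE => ab ->.
by rewrite imsetU1 imset_set1; exact: nxt.
Qed.

End Tree.

(** The centre of a spider has degree at least [m - 2], and a spider has [m + 1] vertices, all in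
    any neighbour-closed set containing the centre. Each alternative violates one of these. *)
Lemma spider_free_local (T : finType) (e : rel T) m :
    4 <= m -> irreflexive e ->
    (forall v, #|[set w | e v w]| <= m - 3 \/
       exists C : {set T}, [/\ #|C| <= m, v \in C & forall u w, u \in C -> e u w -> w \in C]) ->
  spider_free e m.
Proof.
move=> m_ge4 irr loc v x y x' y' U vx vy xx' yy'; apply/negP => le_R.
set R := _ :\: _ in le_R.
have RX : [disjoint R & [set x; y; x'; y']].
  by rewrite disjoints_subset; apply/subsetP => w; rewrite !inE => /andP[].
have [le_d|[C [leC vC Ccl]]] := loc v.
  have : #|[set x; y] :|: R| <= #|[set w | e v w]|.
    apply/subset_leq_card/subsetP => w; rewrite !inE.
    by case/orP=> [/orP[]/eqP->|/andP[]].
  rewrite cardsU cards2; have -> : [set x; y] :&: R = set0.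
    by apply/setP => w; rewrite !inE; case: (w == x); case: (w == y); rewrite ?orbT.
  by rewrite cards0; case/andP: U => _ /andP[]; rewrite inE negb_or => /andP[->]; lia.
have eC := fun u w uC uw => Ccl u w uC uw.
have : #|[set:: [:: v; x; y; x'; y']] :|: R| <= #|C|.
  apply/subset_leq_card/subsetP => w; rewrite !inE.
  have xC := eC _ _ vC vx; have yC := eC _ _ vC vy.
  case/orP=> [/or4P[/eqP->|/eqP->|/eqP->|/orP[]/eqP->]|/andP[_ /(eC _ _ vC)]] //.
    exact: eC xx'.
  exact: eC yy'.
rewrite cardsU; have -> : [set:: [:: v; x; y; x'; y']] :&: R = set0.
  apply/setP => w; rewrite !inE; have [->|] := eqVneq w v; first by rewrite irr andbF.
  by case: (w == x); case: (w == y); case: (w == x'); case: (w == y').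
rewrite cards0 cardsE (card_uniqP U) /=.
lia.
Qed.

(** Extremal graphs can thus be built on any finite type; [enum_val] transports them to ordinals. *)
Lemma ex_ge_card_pairs (T : finType) (e : rel T) (n : nat) :
    5 <= n -> symmetric e -> irreflexive e -> spider_free e n.-1 ->
  #|pairs e setT| <= 2 * ex #|T| (T1 n).
Proof.
move=> n_ge5 sym irr free.
pose g := @enum_val T (mem T).
have g_inj : injective g by exact: enum_val_inj.
have gK u : exists i, g i = u by exists (enum_rank u); exact: enum_rankK.
pose E := [set s | [exists u, exists w, e (g u) (g w) && (s == [set u; w])]].
have adjE u w : adj E u w = e (g u) (g w).
  rewrite /adj inE; apply/existsP/idP => [[a /existsP[b /andP[ab /eqP uw]]]|uw]; last first.
    by exists u; apply/existsP; exists w; rewrite uw eqxx.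
  have ab' : a != b by apply: contraTneq ab => ->; rewrite irr.
  have : a \in [set u; w] by rewrite uw set21.
  have : b \in [set u; w] by rewrite uw set22.
  rewrite !inE => /orP[]/eqP E1 /orP[]/eqP E2; subst => //; rewrite ?eqxx // in ab'.
  by rewrite sym.
have gE : is_graph E.
  apply/forall_inP => s; rewrite inE => /existsP[u /existsP[w /andP[uw /eqP->]]].
  by rewrite cards2; have [E1|] := eqVneq u w; first by rewrite E1 irr in uw.
have noT : ~~ contains E (T1 n).
  apply/negP => /(contains_spider n_ge5 gE); case=> v x y x' y' U vx vy xx' yy'.
  have := free (g v) (g x) (g y) (g x') (g y').
  rewrite -[[:: _; _; _; _; _]]/(map g [:: v; x; y; x'; y']) (map_inj_uniq g_inj) U.
  rewrite -!adjE => /(_ isT vx vy xx' yy'); apply: contra => /leq_trans; apply.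
  rewrite -(card_imset _ g_inj); apply/subset_leq_card/subsetP => z /imsetP[w].
  by rewrite !inE adjE => /andP[wX vw] ->; rewrite vw andbT !(inj_eq g_inj).
have -> : #|pairs e setT| = #|pairs (adj E) setT|.
  have gg_inj : injective (fun z : _ * _ => (g z.1, g z.2)).
    by move=> [a b] [c d] [/g_inj-> /g_inj->].
  rewrite -(card_imset _ gg_inj); congr #|pred_of_set _|; apply/setP => -[a b].
  rewrite !inE /=; apply/idP/imsetP => [ab|[[u w]]].
    have [u ua] := gK a; have [w wb] := gK b; exists (u, w); rewrite ?ua ?wb //.
    by rewrite !inE /= adjE ua wb.
  by rewrite !inE /= adjE => uw [-> ->].
rewrite card_pairs_adj // leq_mul2l /=.
by rewrite /ex; apply: leq_bigmax_cond; rewrite gE.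
Qed.

(** * Extremal graphs *)

Section Blocks.
Variables (Y : finType) (eY : rel Y) (k m : nat).

Definition with_blocks : rel (Y + 'I_k * 'I_m)%type := fun u w =>
  match u, w with
  | inl a, inl b => eY a b
  | inr (i, a), inr (j, b) => (i == j) && (a != b)
  | _, _ => false
  end.

Hypotheses (eY_sym : symmetric eY) (eY_irr : irreflexive eY).

Lemma with_blocks_sym : symmetric with_blocks.
Proof.
by move=> [a|[i a]] [b|[j b]] //=; rewrite 1?[i == j]eq_sym 1?[a == b]eq_sym ?eY_sym.
Qed.

Lemma with_blocks_irr : irreflexive with_blocks.
Proof. by move=> [a|[i a]] /=; rewrite ?eqxx ?eY_irr. Qed.

Lemma card_pairs_with_blocks :
  #|pairs with_blocks setT| = #|pairs eY setT| + k * m * m.-1.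
Proof.
rewrite !card_pairs_setT big_sumType /=; congr (_ + _).
  apply: eq_bigr => a _; rewrite -(card_imset _ (@inl_inj _ ('I_k * 'I_m)%type)).
  congr #|pred_of_set _|; apply/setP => -[b|[j b]]; rewrite !inE /=.
    by rewrite mem_imset ?inE //; exact: inl_inj.
  by apply/esym/imsetP => -[].
rewrite (eq_bigr (fun=> m.-1)) => [|[i a] _].
  by rewrite sum_nat_const cardT -cardE card_prod !card_ord.
have inj : injective (fun b : 'I_m => inr Y (i, b)) by move=> b c [].
rewrite -[in RHS](card_ord m) -(cardsC1 a) -(card_imset _ inj).
congr #|pred_of_set _|; apply/setP => -[b|[j b]]; rewrite !inE /=.
  by apply/esym/imsetP => -[].
apply/andP/imsetP => [[/eqP-> ab]|[c + [-> ->]]]; last by rewrite !inE eqxx eq_sym.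
by exists b; rewrite ?inE 1?eq_sym.
Qed.

Lemma with_blocks_spider_free :
    4 <= m -> (#|Y| <= m \/ forall y, #|[set w | eY y w]| <= m - 3) ->
  spider_free with_blocks m.
Proof.
move=> m_ge4 smallY; apply: spider_free_local => //; first exact: with_blocks_irr.
case=> [y|[i a]]; last first.
  right; exists [set inr (i, b) | b : 'I_m]; split.
  - by rewrite (leq_trans (leq_imset_card _ _)) // card_ord.
  - exact: imset_f.
  - by move=> _ [b|[j b]] /imsetP[c _ ->] //= /andP[/eqP<- _]; exact: imset_f.
case: smallY => [leY|leY]; [right|left].
  exists [set inl b | b : Y]; split.
  - exact: leq_trans (leq_imset_card _ _) leY.
  - exact: imset_f.
  - by move=> _ [b|[j b]] /imsetP[c _ ->] //= _; exact: imset_f.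
apply: leq_trans (leY y); rewrite -[X in _ <= X](card_imset _ (@inl_inj _ ('I_k * 'I_m)%type)).
apply/subset_leq_card/subsetP => -[b|[j b]]; rewrite !inE //= => yb.
by apply/imset_f; rewrite inE.
Qed.

Lemma ex_with_blocks n :
    m = n.-1 -> 5 <= n -> (#|Y| <= m \/ forall y, #|[set w | eY y w]| <= m - 3) ->
  #|pairs eY setT| + k * m * m.-1 <= 2 * ex (#|Y| + k * m) (T1 n).
Proof.
move=> mE n_ge5 smallY.
have := @ex_ge_card_pairs _ with_blocks n n_ge5 with_blocks_sym with_blocks_irr.
rewrite card_pairs_with_blocks -mE card_sum card_prod !card_ord; apply.
by apply: with_blocks_spider_free => //; lia.
Qed.

End Blocks.

(** * Almost regular graphs: a circulant graph plus a matching *)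

Section NearRegular.
Variables (q' d : nat).
Local Notation q := q'.+1.
Hypothesis d_small : d + 3 <= q.

Let step (i : 'I_(d./2)) : 'I_q := inord i.+2.
(** The differences 1 and -1 are left out: they are used by [mates]. *)
Definition jumps : {set 'I_q} :=
  [set step i | i : 'I_(d./2)] :|: [set (- step i)%R | i : 'I_(d./2)].

(** The matching 0-1, 2-3, and so on; if [q] is odd, the last vertex has no mate. *)
Definition mates (u w : 'I_q) : bool := (u != w) && (u./2 == w./2).

(** The circulant part has the even degree [d./2.*2]; for odd [d] the matching supplies the missing
    unit. *)
Definition near_regular : rel 'I_q := fun u w =>
  ((w - u)%R \in jumps) || odd d && mates u w.

Lemma val_step i : val (step i) = i.+2.
Proof. by rewrite /= inordK //; have := ltn_ord i; lia. Qed.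

Lemma jumpsN j : ((- j)%R \in jumps) = (j \in jumps).
Proof.
suff sub i : i \in jumps -> (- i)%R \in jumps.
  by apply/idP/idP => /sub //; rewrite GRing.opprK.
rewrite !inE => /orP[]/imsetP[a _ ->]; rewrite ?GRing.opprK; apply/orP; [right|left];
  by apply/imsetP; exists a.
Qed.

Lemma card_jumps : #|jumps| = d./2.*2.
Proof.
have step_inj : injective step.
  by move=> i j /(congr1 val); rewrite !val_step => -[] /val_inj.
rewrite cardsU !card_imset ?card_ord //; last by move=> i j /GRing.oppr_inj/step_inj.
rewrite (_ : _ :&: _ = set0) ?cards0 ?subn0 ?addnn //.
(* Two jumps add up to at most [d + 2 < q], so no jump is the opposite of another. *)
apply/setP => j; rewrite !inE; apply/andP => -[/imsetP[a _ ->] /imsetP[b _]].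
move/(congr1 val); rewrite [RHS]/= !val_step.
have := ltn_ord a; have := ltn_ord b => ltb lta.
by rewrite modn_small; lia.
Qed.

Lemma mates_sym : symmetric mates.
Proof. by move=> u w; rewrite /mates eq_sym [_./2 == _]eq_sym. Qed.

Lemma near_regular_sym : symmetric near_regular.
Proof. by move=> u w; rewrite /near_regular mates_sym -jumpsN GRing.opprB. Qed.

(** Even after wrapping around, a jump changes the value by at least 2, whereas mates differ by
    1. *)
Lemma jumps_far u w : (w - u)%R \in jumps -> (u != w) && ~~ mates u w.
Proof.
have far (a b : 'I_q) i : (b - a)%R = step i -> (a != b) && ~~ mates a b.
  move=> E; have {E} : b = (step i + a)%R by rewrite -E GRing.subrK.
  move/(congr1 val); rewrite [RHS]/= val_step /mates -val_eqE /=.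
  have := ltn_ord a; have := ltn_ord i => lti lta.
  have [lt|ge] := ltnP (i.+2 + a) q; first by rewrite modn_small // => ->; lia.
  by rewrite -(subnK ge) modnDr modn_small => [->|]; lia.
rewrite inE => /orP[]/imsetP[i _ E]; first exact: far E.
rewrite eq_sym mates_sym; apply: (far _ _ i).
by rewrite -GRing.opprB E GRing.opprK.
Qed.

Lemma near_regular_irr : irreflexive near_regular.
Proof.
move=> u; rewrite /near_regular /mates eqxx andbF orbF.
by apply/negP => /jumps_far; rewrite eqxx.
Qed.

Lemma card_mates (u : 'I_q) : (odd u || (u.+1 < q)) <= #|[set w | mates u w]| <= 1.
Proof.
apply/andP; split.
  have [ok|//] := boolP (odd u || (u.+1 < q)).
  apply/card_gt0P; have ltu := ltn_ord u.
  exists (inord (if odd u then u.-1 else u.+1)); rewrite inE /mates -val_eqE /=.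
  by case: ifP ok => oddu /= ok; rewrite inordK; lia.
apply/card_le1_eqP => a b; rewrite !inE /mates -!val_eqE /= => ua ub.
by apply: val_inj => /=; lia.
Qed.

Lemma near_regular_nb (u : 'I_q) :
  [set w | near_regular u w] =
    [set w : 'I_q | (w - u)%R \in jumps] :|: [set w | odd d && mates u w].
Proof.
apply/setP => w.
by rewrite [RHS]in_setU [LHS]in_set [X in _ = X || _]in_set [X in _ = _ || X]in_set.
Qed.

Lemma card_translate (u : 'I_q) : #|[set w : 'I_q | (w - u)%R \in jumps]| = d./2.*2.
Proof.
rewrite -card_jumps -(card_imset jumps (@GRing.addrI _ u)).
congr #|pred_of_set _|; apply/setP => w; rewrite inE.
apply/idP/imsetP => [wJ|[j jJ ->]]; last by rewrite GRing.addrC GRing.addKr.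
by exists (w - u)%R => //; rewrite GRing.addrC GRing.subrK.
Qed.

Lemma near_regular_deg (u : 'I_q) :
  d./2.*2 + odd d * (odd u || (u.+1 < q)) <= #|[set w | near_regular u w]| <= d.
Proof.
have dE := odd_double_half d; have /andP[ge_m le_m] := card_mates u.
have -> : #|[set w | near_regular u w]| = d./2.*2 + odd d * #|[set w | mates u w]|.
  rewrite near_regular_nb cardsU card_translate.
  rewrite (_ : _ :&: _ = set0) ?cards0 ?subn0.
    congr (_ + _); case: (odd d); first by rewrite mul1n.
    by rewrite mul0n; apply: eq_card0 => w; rewrite inE.
  apply/setP => w; rewrite in_set0 in_setI; apply/andP => -[].
  by rewrite 2!in_set => /jumps_far/andP[_ /negPf->]; rewrite andbF.
by case: (odd d) dE; rewrite ?mul1n ?mul0n; lia.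
Qed.

(** The term [q' + odd q'] is [q] rounded down to an even number, the number of matched vertices. *)
Lemma card_pairs_near_regular :
  q * d./2.*2 + odd d * (q' + odd q') <= #|pairs near_regular setT|.
Proof.
rewrite card_pairs_setT.
have -> : q * d./2.*2 + odd d * (q' + odd q') =
    \sum_(u < q) (d./2.*2 + odd d * (odd u || (u.+1 < q))).
  rewrite big_split /= sum_nat_const card_ord -big_distrr /= big_ord_recr /=.
  rewrite ltnn orbF (eq_bigr (fun=> 1)) ?sum_nat_const ?card_ord ?muln1 // => i _.
  by rewrite ltnS ltn_ord orbT.
apply: leq_sum => u _; have /andP[le_u _] := near_regular_deg u.
by [].
Qed.

End NearRegular.

(** * The extremal number *)

Lemma ex_T1_le p n : 5 <= n -> 2 * ex p (T1 n) + defect n.-1 p <= n.-2 * p.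
Proof.
move=> n_ge5; have m_ge4 : 4 <= n.-1 by lia.
have defect_le : defect n.-1 p <= n.-2 * p.
  (* The sparsity bound for the edgeless graph shows that the truncated subtraction below is
     exact. *)
  pose e0 : rel 'I_p := fun _ _ => false.
  have sym : symmetric e0 by []; have irr : irreflexive e0 by [].
  have free : spider_free e0 n.-1 by [].
  have := spider_free_sparse sym irr m_ge4 free setT.
  by rewrite /sparse cardsT card_ord; apply: leq_trans; rewrite leq_addl.
suff : ex p (T1 n) <= (n.-2 * p - defect n.-1 p)./2.
  by move: defect_le; move: (n.-2 * p) (defect _ p) (ex p _); clear; lia.
apply/bigmax_leqP => E /andP[gE noT].
have := spider_free_sparse (adj_sym E) (adj_irr gE) m_ge4 (spider_contains n_ge5 gE noT) setT.
rewrite /sparse card_pairs_adj // cardsT card_ord.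
by move: (n.-2 * p) (defect _ p) (nedges E); clear; lia.
Qed.

Lemma ex_T1_ge_cliques k r n : 5 <= n -> r <= n.-1 ->
  r * r.-1 + k * n.-1 * n.-2 <= 2 * ex (r + k * n.-1) (T1 n).
Proof.
move=> n_ge5 le_r.
have sym : symmetric (fun a b : 'I_r => a != b) by move=> a b; rewrite eq_sym.
have irr : irreflexive (fun a b : 'I_r => a != b) by move=> a; rewrite eqxx.
have := @ex_with_blocks _ _ k n.-1 sym irr n erefl n_ge5.
rewrite card_ord card_pairs_setT => /(_ (or_introl le_r)); apply: leq_trans.
rewrite leq_add2r (eq_bigr (fun=> r.-1)) ?sum_nat_const ?card_ord // => a _.
rewrite -[in RHS](card_ord r) -(cardsC1 a); apply: eq_card => b.
by rewrite !inE eq_sym.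
Qed.

Lemma ex_T1_ge_near_regular k r n : 5 <= n ->
  ((n - 4) * (n.-1 + r))./2.*2 + k * n.-1 * n.-2 <= 2 * ex (n.-1 + r + k * n.-1) (T1 n).
Proof.
move=> n_ge5; have [q' q'E] : exists q', n.-1 + r = q'.+1 by exists (n.-2 + r); lia.
have d_small : n - 4 + 3 <= q'.+1 by rewrite -q'E; lia.
have deg (y : 'I_q'.+1) : #|[set w | near_regular (n - 4) y w]| <= n.-1 - 3.
  by have /andP[_] := near_regular_deg d_small y; rewrite -subn1 -subnDA.
have := @ex_with_blocks _ _ k n.-1 (@near_regular_sym q' (n - 4))
  (near_regular_irr d_small) n erefl n_ge5 (or_intror deg).
rewrite card_ord q'E; apply: leq_trans.
rewrite leq_add2r; apply: leq_trans (card_pairs_near_regular d_small).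
move: (n - 4) {deg d_small} => d; rewrite -{1}(odd_double_half d).
move: d./2 => h; case: (odd d); rewrite ?mul0n ?mul1n ?add0n; last first.
  by rewrite mulnC; have := odd_double_half (q'.+1 * h.*2); lia.
rewrite -!muln2; have := odd_double_half q'.
have -> : (1 + h * 2) * q'.+1 = q'.+1 + (q'.+1 * h).*2 by rewrite -!muln2; nia.
by rewrite -!muln2; lia.
Qed.

(** * Arithmetic of the two constructions *)

Lemma cliques_count k r m : r < m ->
  r * r.-1 + k * m * m.-1 = m.-1 * (r + k * m) - r * (m - r).
Proof.
move=> lt_rm; have [s ->] : exists s, m = r + s.+1 by exists (m - r).-1; lia.
have -> : r + s.+1 - r = s.+1 by lia.
by rewrite addnS /=; case: r {lt_rm} => [|r] /=; nia.
Qed.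

(** One clique is merged with the [r] remaining vertices, leaving [k.-1]. Since [m (m - 1)] is even,
    these do not affect the rounding. *)
Lemma near_regular_count k r m : 4 <= m -> 0 < k ->
  (m.-1 * (r + k * m)) %/ 2 - (m + r) <=
    (((m - 3) * (m + r))./2.*2 + k.-1 * m * m.-1) %/ 2.
Proof.
move=> m_ge4; case: k => // k _ /=.
have [c cE] : exists c, k * m * m.-1 = c.*2.
  exists (k * (m * m.-1)./2); rewrite doubleMr -mulnA; congr (_ * _).
  have := odd_double_half (m * m.-1); rewrite oddM; case: (m) m_ge4 => // m' _ /=.
  by rewrite andNb add0n => ->.
have -> : m.-1 * (r + k.+1 * m) = (m - 3) * (m + r) + 2 * (m + r) + c.*2.
  rewrite -cE; have [s ->] : exists s, m = s + 3 by exists (m - 3); lia.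
  by rewrite addnK addn3 /=; nia.
by rewrite cE; move: (m + r) => S; move: ((m - 3) * S); clear; lia.
Qed.

(** With [a = r - 2] and [b = m - r - 4], the difference [r (m - r) - 2 (m + r)] equals [a b - 8],
    so the claim is [a b >= 8]. *)
Lemma quad_ge m r : 4 <= m ->
    ((15 <= m) && (3 <= r <= m - 5)) || ((12 <= m <= 14) && (4 <= r <= m - 6)) ->
  2 * (m + r) <= r * (m - r).
Proof.
move=> m_ge4 cond.
have [a [b [rE mE ab]]] : exists a b, [/\ r = a + 2, m = (a + 2) + (b + 4) &
    [|| (0 < a) && (0 < b) && (8 < a + b) | (1 < a) && (1 < b) && (5 < a + b)]].
  by exists (r - 2), (m - r - 4); split; lia.
by rewrite mE rE addKn; nia.
Qed.

(** For [r <= 2] or [m - r <= 4] one factor alone gives the bound; otherwise the claim is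
    [(r - 2) (m - r - 4) <= 8]. *)
Lemma quad_le m r : 4 <= m -> r < m ->
    ~~ (((15 <= m) && (3 <= r <= m - 5)) || ((12 <= m <= 14) && (4 <= r <= m - 6))) ->
  r * (m - r) <= 2 * (m + r).
Proof.
move=> m_ge4 lt_rm; have [s s_gt0 ->] : exists2 s, 0 < s & m = r + s by exists (m - r); lia.
rewrite addKn => cond; have [r_le2|r_gt2] := leqP r 2; first by nia.
have [s_le4|s_gt4] := leqP s 4; first by nia.
have [a [b [-> -> ab]]] : exists a b, [/\ r = a + 3, s = b + 5 &
   [|| (a == 0) && (b <= 6), (b == 0) && (a <= 6) | (a + b <= 3)]].
  by exists (r - 3), (s - 5); split; lia.
by nia.
Qed.

Theorem theorem2p1 (p n : nat) (hn : 4 <= n - 1) (hp : n - 1 <= p) :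
  let r := p %% (n - 1) in
  let A := ((n - 2) * p) %/ 2 - (n - 1 + r) in
  let B := ((n - 2) * p - r * (n - 1 - r)) %/ 2 in
  ex p (T1 n) = maxn A B /\
  ex p (T1 n) =
    (if ((16 <= n) && (3 <= r <= n - 6)) || ((13 <= n <= 15) && (4 <= r <= n - 7))
     then A else B).
Proof.
move=> r A B; have n_ge5 : 5 <= n by lia.
set m := n - 1 in hn hp r A B *.
have m1E : n.-1 = m by rewrite /m subn1.
have n2E : n - 2 = m.-1 by rewrite /m; lia.
have r_lt : r < m by rewrite ltn_mod; lia.
set k := p %/ m; have pE : r + k * m = p by rewrite addnC -divn_eq.
have k_gt0 : 0 < k by rewrite divn_gt0 //; lia.
set X := (n - 2) * p; set g := r * (m - r); set h := 2 * (m + r).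
have XE : X = m.-1 * (r + k * m) by rewrite /X n2E pE.
have leB : B <= ex p (T1 n).
  have := @ex_T1_ge_cliques k r n n_ge5.
  rewrite m1E pE (cliques_count k r_lt) pE -n2E => /(_ (ltnW r_lt)).
  by rewrite /B -/X -/g; move: (X - g) (ex p _); clear; lia.
have leA : A <= ex p (T1 n).
  have := @ex_T1_ge_near_regular k.-1 r n n_ge5; rewrite m1E.
  have -> : m + r + k.-1 * m = p.
    by rewrite -pE -{2}(prednK k_gt0) mulSn addnCA addnA.
  have := near_regular_count r hn k_gt0; rewrite -XE -/A.
  have -> : n - 4 = m - 3 by rewrite /m; lia.
  move: (_ + _ * _ * _) (ex p _) => u v; rewrite /A; move: (_ - (m + r)); clear; lia.
have le_ex := ex_T1_le p n_ge5.
rewrite m1E /defect ltnNge hp /= -n2E -/r -/X -/g -/h in le_ex.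
(* [A] and [B] are the halves, rounded down, of [X - h] and [X - g], so comparing [g] with [h]
   decides which is larger. *)
have leBA : h <= g -> B <= A.
  by rewrite /A /B -/X -/g /h; move: (X) (g) (m + r); clear; lia.
have leAB : g <= h -> A <= B.
  by rewrite /A /B -/X -/g /h; move: (X) (g) (m + r); clear; lia.
have exE : ex p (T1 n) = maxn A B.
  apply/eqP; rewrite eqn_leq geq_max leA leB !andbT leq_max; move: le_ex.
  rewrite /A /B -/X -/g /h; move: (X) (g) (m + r) (ex p _); clear; lia.
have condE : ((16 <= n) && (3 <= r <= n - 6)) || ((13 <= n <= 15) && (4 <= r <= n - 7)) =
    ((15 <= m) && (3 <= r <= m - 5)) || ((12 <= m <= 14) && (4 <= r <= m - 6)).
  by move: n_ge5; rewrite /m; move: (r); clear; lia.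
split=> //; rewrite exE condE; case: ifPn => [/(quad_ge hn)/leBA|/(quad_le hn r_lt)/leAB].
  by move/maxn_idPl.
by move/maxn_idPr.
Qed.
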